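(* Let $(X_{\alpha},\delta_{\alpha})_{\alpha\in I}$ be a collection of separated proximity spaces and let $(\coprod_{\alpha}X_{\alpha},\delta)$ be its coproduct. Then the Smirnov compactification of $(\coprod_{\alpha}X_{\alpha},\delta)$ is homeomorphic, as a compactification, to the Stone-Čech compactification of $\coprod_{\alpha}X_{\alpha}$ (with the topology induced by $\delta$) if and only if for every $\alpha$ the Smirnov compactification of $(X_{\alpha},\delta_{\alpha})$ is homeomorphic, as a compactification, to the Stone-Čech compactification of $X_{\alpha}$ (with the topology induced by $\delta_{\alpha}$).
   Context: A proximity on a set $X$ is a binary relation $\delta$ on the power set of $X$ such that for all $A,B,C\subseteq X$: (1) $A\delta B\Rightarrow B\delta A$; (2) $A\delta B\Rightarrow A,B\neq\emptyset$; (3) $A\cap B\neq\emptyset\Rightarrow A\delta B$; (4) $A\delta(B\cup C)\iff A\delta B$ or $A\delta C$; (5) if not $A\delta B$, then there is $E\subseteq X$ with not $A\delta E$ and not $(X\setminus E)\delta B$. It is separated if $\{x\}\delta\{y\}\iff x=y$. It induces a completely regular topology on $X$ (Hausdorff when $\delta$ is separated): $A$ is closed iff ($\{x\}\delta A$ implies $x\in A$). The coproduct of proximity spaces $(X_\alpha,\delta_\alpha)_{\alpha\in I}$ ($I$ an arbitrary index set) is the disjoint union $\coprod_\alpha X_\alpha$ with $A\delta B\iff A_\alpha\delta_\alpha B_\alpha$ for some $\alpha$, where $A_\alpha:=A\cap X_\alpha$. A cluster in a separated proximity space $(X,\delta)$ is a nonempty collection $\sigma$ of subsets of $X$ such that: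 (1) $A\delta B$ for all $A,B\in\sigma$; (2) if $C\delta A$ for all $A\in\sigma$ then $C\in\sigma$; (3) if $A\cup B\in\sigma$ then $A\in\sigma$ or $B\in\sigma$. Let $\mathfrak{X}$ be the set of all clusters; $C\subseteq X$ absorbs $\mathcal{A}\subseteq\mathfrak{X}$ if $C\in\sigma$ for every $\sigma\in\mathcal{A}$. Define $\mathcal{A}\delta^{*}\mathcal{B}$ iff $A\delta B$ for all $A,B\subseteq X$ absorbing $\mathcal{A},\mathcal{B}$ respectively. Then $(\mathfrak{X},\delta^{*})$ is a separated proximity space with compact Hausdorff induced topology, the Smirnov compactification of $(X,\delta)$, in which $X$ is densely embedded via $x\mapsto\{A\subseteq X:\{x\}\delta A\}$. Two compactifications of $X$ are homeomorphic as compactifications if there is a homeomorphism between them that restricts to the identity on $X$. *)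

(* Defs.v *)
From HB Require Import structures.
From mathcomp Require Import all_boot all_order all_algebra.
From mathcomp Require Import all_classical all_reals all_analysis.

Set Implicit Arguments.
Unset Strict Implicit.
Unset Printing Implicit Defensive.

Import Order.TTheory GRing.Theory Num.Theory.
Import numFieldTopology.Exports.

Local Open Scope classical_set_scope.
Local Open Scope ring_scope.

Record proximity (X : Type) := Proximity {
  prox :> set X -> set X -> Prop;
  prox_sym : forall A B, prox A B -> prox B A;
  prox_neq0 : forall A B, prox A B -> A !=set0 /\ B !=set0;
  prox_meet : forall A B, A `&` B !=set0 -> prox A B;
  proxU : forall A B C, prox A (B `|` C) <-> prox A B \/ prox A C;
  prox_strong : forall A B, ~ prox A B ->
    exists E, ~ prox A E /\ ~ prox (~` E) B }.

Definition separated_prox (X : Type) (d : proximity X) : Prop :=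
  forall x y : X, d [set x] [set y] <-> x = y.

Lemma prox_subr (X : Type) (d : proximity X) (A B C : set X) :
  B `<=` C -> d A B -> d A C.
Proof. by move=> /setUidPr <- dAB; apply/proxU; left. Qed.

Lemma prox_subl (X : Type) (d : proximity X) (A B C : set X) :
  A `<=` B -> d A C -> d B C.
Proof. by move=> AB /prox_sym dCA; apply/prox_sym; exact: prox_subr AB dCA. Qed.

(* [prox_space d] is a copy of [X] carrying the topology induced by [d]. *)
Definition prox_space (X : Type) (d : proximity X) : Type := X.

Section InducedTopology.
Variables (X : Type) (d : proximity X).

Definition prox_closed (A : set X) : Prop := forall x, d [set x] A -> A x.

Let op (A : set X) : Prop := prox_closed (~` A).

Let opT : op setT.
Proof. by move=> x /prox_neq0[_ [y]]; rewrite setCT. Qed.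

Let opI : setI_closed op.
Proof.
by move=> A B oA oB x; rewrite setCI => /proxU[/oA|/oB]; [left|right].
Qed.

Let op_bigU (J : Type) (f : J -> set X) :
  (forall j, op (f j)) -> op (\bigcup_j f j).
Proof.
move=> of_ x dx [j _ fjx]; apply: (of_ j x) => //.
by apply: prox_subr dx => y ny fjy; apply: ny; exists j.
Qed.

HB.instance Definition _ := gen_eqMixin (prox_space d).
HB.instance Definition _ := gen_choiceMixin (prox_space d).
HB.instance Definition _ :=
  @isOpenTopological.Build (prox_space d) op opT opI op_bigU.

End InducedTopology.

Section Coproduct.
Variables (I : Type) (X : I -> Type) (d : forall i, proximity (X i)).

(* [existT X i @^-1` A] is the trace of [A] on the summand [X i]. *)
Definition coprod_rel (A B : set {i : I & X i}) : Prop :=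
  exists i, d i (existT X i @^-1` A) (existT X i @^-1` B).

Let coprod_sym A B : coprod_rel A B -> coprod_rel B A.
Proof. by move=> [i /prox_sym ?]; exists i. Qed.

Let coprod_neq0 A B : coprod_rel A B -> A !=set0 /\ B !=set0.
Proof.
by move=> [i /prox_neq0[[x Ax] [y By]]]; split; [exists (existT X i x)|
  exists (existT X i y)].
Qed.

Let coprod_meet A B : A `&` B !=set0 -> coprod_rel A B.
Proof. by move=> [[i x] [Ax Bx]]; exists i; apply: prox_meet; exists x. Qed.

Let coprodU A B C :
  coprod_rel A (B `|` C) <-> coprod_rel A B \/ coprod_rel A C.
Proof.
split=> [[i]|[[i dAB]|[i dAC]]].
- by rewrite preimage_setU => /proxU[]; [left|right]; exists i.
- by exists i; rewrite preimage_setU; apply/proxU; left.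
- by exists i; rewrite preimage_setU; apply/proxU; right.
Qed.

Let coprod_strong A B : ~ coprod_rel A B ->
  exists E, ~ coprod_rel A E /\ ~ coprod_rel (~` E) B.
Proof.
move=> nAB.
have E i : {Ei : set (X i) |
    ~ d i (existT X i @^-1` A) Ei /\ ~ d i (~` Ei) (existT X i @^-1` B)}.
  by apply/cid/prox_strong => dAB; apply: nAB; exists i.
exists [set z | sval (E (projT1 z)) (projT2 z)].
by split=> -[i] dE; have [nAE nEB] := svalP (E i); [exact: nAE|exact: nEB].
Qed.

Definition coprod_prox : proximity {i : I & X i} :=
  Proximity coprod_sym coprod_neq0 coprod_meet coprodU coprod_strong.

End Coproduct.

Section Smirnov.
Variables (X : Type) (d : proximity X).

Record is_prox_cluster (s : set (set X)) : Prop := IsProxCluster {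
  prox_cluster_neq0 : s !=set0;
  prox_cluster_near : forall A B, s A -> s B -> d A B;
  prox_cluster_max : forall C, (forall A, s A -> d C A) -> s C;
  prox_cluster_prime : forall A B, s (A `|` B) -> s A \/ s B }.

Record prox_cluster := ProxCluster {
  prox_cluster_set :> set X -> Prop;
  prox_clusterP : is_prox_cluster prox_cluster_set }.

Definition absorbs (C : set X) (S : set prox_cluster) : Prop :=
  forall s : prox_cluster, S s -> s C.

Definition smirnov_rel (S T : set prox_cluster) : Prop :=
  forall A B, absorbs A S -> absorbs B T -> d A B.

Let clusterS (s : prox_cluster) A B : A `<=` B -> s A -> s B.
Proof.
move=> AB sA; apply: (prox_cluster_max (prox_clusterP s)) => C sC.
exact: prox_subl AB (prox_cluster_near (prox_clusterP s) sA sC).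
Qed.

Let clusterC (s : prox_cluster) A : s A \/ s (~` A).
Proof.
apply: (prox_cluster_prime (prox_clusterP s)); rewrite setUv.
by have [B sB] := prox_cluster_neq0 (prox_clusterP s); exact: clusterS sB.
Qed.

Let cluster_far (s : prox_cluster) A B : s A -> ~ d A B -> ~ s B.
Proof.
by move=> sA nAB sB; apply: nAB; exact: (prox_cluster_near (prox_clusterP s)).
Qed.

Let smirnov_sym S T : smirnov_rel S T -> smirnov_rel T S.
Proof. by move=> ST A B AT BS; apply/prox_sym; exact: ST. Qed.

Let smirnov_neq0 S T : smirnov_rel S T -> S !=set0 /\ T !=set0.
Proof.
move=> ST; split; apply: contrapT => /set0P/negP/negPn/eqP E0.
- have /prox_neq0[[]] // : d set0 setT; apply: ST; first by rewrite E0.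
  by move=> s _; case: (clusterC s setT) => //; exact: clusterS.
- have /prox_neq0[_ []] // : d setT set0; apply: ST; last by rewrite E0.
  by move=> s _; case: (clusterC s setT) => //; exact: clusterS.
Qed.

Let smirnov_meet S T : S `&` T !=set0 -> smirnov_rel S T.
Proof.
move=> [s [Ss Ts]] A B AS BT.
by apply: (prox_cluster_near (prox_clusterP s)); [exact: AS|exact: BT].
Qed.

Let smirnovN S T : ~ smirnov_rel S T ->
  exists A B, [/\ absorbs A S, absorbs B T & ~ d A B].
Proof.
move=> nST; apply: contrapT => nE; apply: nST => A B AS BT.
by apply: contrapT => nAB; apply: nE; exists A, B.
Qed.

(* If [A] absorbs [S] and is far from [E], then [~` E] absorbs [S]. *)
Let absorbsC A E S : absorbs A S -> ~ d A E -> absorbs (~` E) S.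
Proof.
move=> AS nAE s Ss; case: (clusterC s E) => // sE.
by case: (cluster_far (AS s Ss) nAE).
Qed.

Let smirnovU S T U :
  smirnov_rel S (T `|` U) <-> smirnov_rel S T \/ smirnov_rel S U.
Proof.
split=> [STU|[H|H] A B AS BTU]; last 2 first.
- by apply: H => // s Ts; apply: BTU; left.
- by apply: H => // s Us; apply: BTU; right.
apply: contrapT => /not_orP[/smirnovN[A [B [AS BT nAB]]]].
move=> /smirnovN[A' [B' [A'S B'U nAB']]].
have [E [nAE nEB]] := prox_strong nAB.
have [E' [nAE' nEB']] := prox_strong nAB'.
have /proxU[] // : d (~` (E `|` E')) (B `|` B').
- apply: STU => s.
    move=> Ss; case: (clusterC s (E `|` E')) => //.
    move=> /(prox_cluster_prime (prox_clusterP s))[].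
      by move/(cluster_far (AS s Ss) nAE).
    by move/(cluster_far (A'S s Ss) nAE').
  move=> [/BT|/B'U]; apply: clusterS; [exact: subsetUl|exact: subsetUr].
- by move=> h; apply: nEB; apply: prox_subl h; rewrite setCU => x [].
- by move=> h; apply: nEB'; apply: prox_subl h; rewrite setCU => x [].
Qed.

Let smirnov_strong S T : ~ smirnov_rel S T ->
  exists E, ~ smirnov_rel S E /\ ~ smirnov_rel (~` E) T.
Proof.
move=> /smirnovN[A [B [AS BT nAB]]].
have [E [nAE nEB]] := prox_strong nAB.
exists [set s : prox_cluster | s E]; split=> h.
- by apply: nAE; apply: h => // s.
- by apply: nEB; apply: h => // s /= nsE; case: (clusterC s E).
Qed.

Definition smirnov_prox : proximity prox_cluster :=
  Proximity smirnov_sym smirnov_neq0 smirnov_meet smirnovU smirnov_strong.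

Lemma point_clusterP (x : X) : is_prox_cluster [set A | d [set x] A].
Proof.
have dxx : d [set x] [set x] by apply: prox_meet; exists x.
split=> [|A B /= xA xB|C /(_ _ dxx)/prox_sym //|A B /= /proxU//].
  by exists [set x].
apply: contrapT => /prox_strong[E [nAE nEB]].
have [Ex|nEx] := pselect (E x).
  by apply: nAE; apply: prox_sym; apply: prox_subl xA => _ ->.
by apply: nEB; apply: prox_subl xB => _ ->.
Qed.

Definition point_cluster (x : X) : prox_cluster :=
  ProxCluster (point_clusterP x).

Definition smirnov : topologicalType := prox_space smirnov_prox.

Definition smirnov_emb : prox_space d -> smirnov := point_cluster.

End Smirnov.

(* The Stone-Cech compactification of [X] is the closure of the image of [X]
   in the cube [0, 1]^C(X, [0, 1]) under the evaluation map; subsets coerce to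
   types carrying the subspace topology. *)
Section StoneCech.
Variables (R : realType) (X : topologicalType).

Definition unit_interval : topologicalType := set_type (`[0, 1] : set R).

Definition cube : topologicalType :=
  prod_topology (fun _ : continuousType X unit_interval => unit_interval).

Definition cube_eval (x : X) : cube := fun f => f x.

Definition stone_cech : topologicalType := set_type (closure (range cube_eval)).

Lemma cube_eval_closure (x : X) : cube_eval x \in closure (range cube_eval).
Proof. by apply/mem_set/subset_closure; exists x. Qed.

Definition stone_cech_emb (x : X) : stone_cech := SigSub (cube_eval_closure x).

End StoneCech.

(* [K1] and [K2] are compactifications of [X] via [e1] and [e2]. *)
Definition homeomorphic_compactifications (X K1 K2 : topologicalType)
    (e1 : X -> K1) (e2 : X -> K2) : Prop :=
  exists (h : K1 -> K2) (g : K2 -> K1),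
    [/\ cancel h g, cancel g h, continuous h, continuous g
      & forall x, h (e1 x) = e2 x].

(* Main.v *)
Require Import Defs.
From mathcomp Require Import all_boot all_order all_algebra.
From mathcomp Require Import all_classical all_reals all_analysis.

(** Whether the Smirnov compactification is the Stone-Cech compactification can
    be read off from the proximity alone, in a form that is compatible with
    coproducts.

    The proximity of [X] can be recovered from its Smirnov compactification:
    two sets are near exactly when their closures there meet, because two near
    sets always lie in a common cluster. Conversely this property
    characterizes the Smirnov compactification: if [X] is mapped densely to a
    compact Hausdorff space [K] in such a way that nearness in [X] is meeting
    of closures in [K], then sending a point [p] of [K] to the collection of
    the sets whose closure contains [p] is a homeomorphism from [K] onto the
    space of clusters ([smirnov_homeo_prox] and [prox_smirnov_homeo]).

    In the Stone-Cech compactification, the closures of two sets are disjoint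
    exactly when a continuous function to the unit interval separates the sets:
    such a function extends, and conversely a compact Hausdorff space is normal
    ([stone_cech_closures]). Hence the two compactifications of [X] agree if
    and only if the far sets are exactly those separated by a continuous
    function ([smirnov_stone_cechP]).

    Finally, both conditions are checked summand by summand in a coproduct. Two
    sets are far in the coproduct if and only if their traces on every summand
    are far, by definition, and they are separated if and only if all their
    traces are, because the coproduct carries the disjoint union topology, so
    that separating functions on the summands glue ([coprod_separatorP]). A
    summand is recovered by viewing its subsets as subsets of the coproduct,
    whose other traces are empty. *)

Set Implicit Arguments.
Unset Strict Implicit.
Unset Printing Implicit Defensive.

Import Order.TTheory GRing.Theory Num.Theory.
Import numFieldTopology.Exports.

Local Open Scope classical_set_scope.
Local Open Scope ring_scope.

(** * The topology induced by a proximity *)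

Section Proximity.
Variables (X : Type) (d : proximity X).
Implicit Types A B : set X.

Lemma prox_closedP (A : set (prox_space d)) : closed A <-> prox_closed d A.
Proof. by rewrite -openC /open /= setCK. Qed.

(** A set cannot be made near to [A] by adding its adherent points: this is
    what the separation axiom [prox_strong] provides, and it makes closure by
    nearness idempotent. *)
Lemma prox_adherent A B : d A [set x | d [set x] B] -> d A B.
Proof.
move=> dAB; apply: contrapT => /prox_strong[E [nAE nEB]]; apply: nAE.
apply: prox_subr dAB => x /= dxB; apply: contrapT => nEx; apply: nEB.
by apply: prox_subl dxB => _ ->.
Qed.

Lemma closure_prox (A : set (prox_space d)) :
  closure A = [set x | d [set x] A].
Proof.
apply/seteqP; split=> [x Ax|x dxA].
  have /prox_closedP : prox_closed d [set x | d [set x] A].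
    by move=> y; exact: prox_adherent.
  by apply; apply: closureS Ax => y Ay; apply: prox_meet; exists y.
apply: (proj1 (prox_closedP _) (@closed_closure _ A)).
exact: prox_subr (@subset_closure _ A) dxA.
Qed.

End Proximity.

(** * Clusters and the Smirnov space *)

Section Clusters.
Variables (X : Type) (d : proximity X).
Implicit Types (A B C : set X) (s t : prox_cluster d).

Lemma prox_clusterS s A B : A `<=` B -> s A -> s B.
Proof.
move=> AB sA; apply: (prox_cluster_max (prox_clusterP s)) => C sC.
exact: prox_subl AB (prox_cluster_near (prox_clusterP s) sA sC).
Qed.

Lemma prox_clusterT s : s setT.
Proof.
by have [B sB] := prox_cluster_neq0 (prox_clusterP s); exact: prox_clusterS sB.
Qed.

Lemma prox_cluster0 s : ~ s set0.
Proof.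
by move=> s0; have /prox_neq0[[]] := prox_cluster_near (prox_clusterP s) s0 s0.
Qed.

Lemma prox_cluster_far s A B : s A -> ~ d A B -> ~ s B.
Proof.
by move=> sA nAB sB; apply: nAB; exact: (prox_cluster_near (prox_clusterP s)).
Qed.

Lemma prox_clusterN s A : ~ s A -> exists2 B, s B & ~ d A B.
Proof.
move=> nsA; apply: contrapT => nB; apply: nsA.
apply: (prox_cluster_max (prox_clusterP s)) => B sB.
by apply: contrapT => nAB; apply: nB; exists B.
Qed.

(** Two nested clusters coincide, since the members of the larger one are near
    all the members of the smaller one. *)
Lemma prox_cluster_eq s t : (forall A, s A -> t A) -> s = t.
Proof.
move=> st; have E : (s : set X -> Prop) = t.
  apply/seteqP; split=> // A tA; apply: (prox_cluster_max (prox_clusterP s)).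
  by move=> B /st; exact: (prox_cluster_near (prox_clusterP t)).
case: s t E {st} => [s Ps] [t Pt] /= E.
by move: Ps; rewrite E => Ps; congr ProxCluster; exact: Prop_irrelevance.
Qed.

(** All later topological facts on the Smirnov space go through this
    identification of membership in a cluster with adherence. *)
Lemma closure_smirnov_emb A :
  closure (@smirnov_emb X d @` A) = [set s | s A].
Proof.
rewrite [LHS](@closure_prox _ (smirnov_prox d)).
apply/seteqP; split=> [s sA|s /= sA B C Bs CA].
  apply: (prox_cluster_max (prox_clusterP s)) => B sB.
  apply/prox_sym; apply: sA => [_ -> //|_ [x Ax <-]].
  by apply: prox_meet; exists x.
apply: prox_adherent; apply: (@prox_subr _ _ _ A).
  by move=> x Ax /=; apply: (CA (point_cluster d x)); exists x.
by apply: (prox_cluster_near (prox_clusterP s)) => //; exact: Bs.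
Qed.

Lemma closed_smirnov_mem A : closed [set s : smirnov d | s A].
Proof. by rewrite -closure_smirnov_emb; exact: closed_closure. Qed.

(** The sets of the form [[set s | s A]] are a base of closed sets, which
    reduces continuity of maps into the Smirnov space to these sets. *)
Lemma smirnov_closureE (S : set (smirnov d)) :
  closure S = \bigcap_(A in [set A | absorbs A S]) [set s | s A].
Proof.
apply/seteqP; split=> [s Ss A AS|s sS].
  by apply: (@closed_smirnov_mem A); apply: closureS Ss.
rewrite [closure _](@closure_prox _ (smirnov_prox d)).
rewrite /= -/(smirnov_rel [set s] S) => A B As BS.
by apply: (prox_cluster_near (prox_clusterP s)); [exact: As|exact: sS].
Qed.

(** If [A] is in [s], [B] in [t] and [A] is far from [B], the interpolating set
    [E] is not in [s] and its complement is not in [t]; these two open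
    conditions exclude each other since every cluster contains [E] or
    [~` E]. *)
Lemma smirnov_hausdorff : hausdorff_space (smirnov d).
Proof.
move=> s t st; apply: prox_cluster_eq => A sA.
apply: contrapT => /prox_clusterN[B tB /prox_strong[E [nAE nEB]]].
have [||u [/= uE uE']] := st (~` [set u | u E]) (~` [set u | u (~` E)]).
- apply: open_nbhs_nbhs; split; first exact/closed_openC/closed_smirnov_mem.
  exact: prox_cluster_far sA nAE.
- apply: open_nbhs_nbhs; split; first exact/closed_openC/closed_smirnov_mem.
  by apply: prox_cluster_far tB _ => /prox_sym.
- case: uE'; have : u (E `|` ~` E) by rewrite setUv; exact: prox_clusterT.
  by move/(prox_cluster_prime (prox_clusterP u)) => [].
Qed.

(** A filter whose cluster points in a compactification are adherent to both
    [A] and [B]. It is proper because a union of a set far from [A] and a set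
    far from [B] cannot be the whole space: [A] would be contained in the
    latter, hence be far from [B]. *)
Lemma prox_filter A B : d A B -> exists2 F : set_system X, ProperFilter F &
  forall E, ~ d A E \/ ~ d B E -> F (~` E).
Proof.
move=> dAB.
exists [set V | exists P Q, [/\ ~ d A P, ~ d B Q & ~` V `<=` P `|` Q]].
  split.
    move=> [P [Q [nAP nBQ]]]; rewrite setC0 => PQ.
    apply: nBQ; apply/prox_sym; apply: prox_subl dAB => x Ax.
    by have [//|Px|//] := PQ x; case: nAP; apply: prox_meet; exists x.
  split.
  - exists set0, set0; split; rewrite ?setCT//.
      by move=> /prox_neq0[_ []].
    by move=> /prox_neq0[_ []].
  - move=> V W [P [Q [AP BQ VPQ]]] [P' [Q' [AP' BQ' WPQ]]].
    exists (P `|` P'), (Q `|` Q'); split; [by move/proxU=> []..|].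
    rewrite setCI setUACA; exact: setUSS.
  - move=> V W VW [P [Q [AP BQ VPQ]]]; exists P, Q; split => //.
    by apply: subset_trans VPQ; exact: subsetC.
move=> E [nAE|nBE].
  by exists E, set0; split; rewrite ?setCK ?setU0// => /prox_neq0[_ []].
by exists set0, E; split; rewrite ?setCK ?set0U// => /prox_neq0[_ []].
Qed.

(** A cluster is in general not a filter, but it is the grill of this one: the
    sets outside the cluster form an ideal. *)
Definition cluster_dual s : set_system X := [set V | ~ s (~` V)].

Lemma cluster_dual_filter s : ProperFilter (cluster_dual s).
Proof.
rewrite /cluster_dual; split.
  by rewrite /= setC0 => /(_ (prox_clusterT s)).
split.
- by rewrite /= setCT; exact: prox_cluster0.
- move=> V W /= nV nW; rewrite setCI.
  by move=> /(prox_cluster_prime (prox_clusterP s))[].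
- by move=> V W VW /= nV sW; apply: nV; apply: prox_clusterS sW; exact: subsetC.
Qed.

End Clusters.

(** * Compactifications in which nearness is meeting of closures *)

Section SmirnovUnique.
Variables (X : Type) (d : proximity X) (K : topologicalType).
Variable (e : prox_space d -> K).
Hypotheses (K_compact : compact [set: K]) (K_hausdorff : hausdorff_space K).

(** Through the homeomorphism, a point [p] of [K] becomes the cluster of all
    sets whose closure contains [p]. Two members of a cluster are near;
    conversely near sets are made to share a cluster by taking a cluster point
    of [prox_filter] in the compact space [K]. *)
Lemma smirnov_homeo_prox :
  homeomorphic_compactifications (@smirnov_emb X d) e ->
  forall A B, d A B <-> closure (e @` A) `&` closure (e @` B) !=set0.
Proof.
move=> [h [g [hK gK ch cg he]]] A B.
have ge x : g (e x) = smirnov_emb x by rewrite -he hK.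
have memg C p : closure (e @` C) p -> g p C.
  move=> Cp; have /continuous_closedP/(_ _ (@closed_smirnov_mem _ d C)) := cg.
  apply; apply: closureS Cp => _ [x Cx <-] /=; rewrite ge.
  by apply: prox_meet; exists x.
have memh C p : g p C -> closure (e @` C) p.
  rewrite -{2}[p]gK => pC.
  have /continuous_closedP/(_ _ (@closed_closure _ (e @` C))) := ch; apply.
  suff: closure (@smirnov_emb X d @` C) (g p).
    apply: closureS => _ [x Cx <-] /=; rewrite he; apply: subset_closure.
    by exists x.
  by rewrite closure_smirnov_emb.
split=> [/prox_filter[F FF dF]|[p [/memg pA /memg pB]]]; last first.
  exact: (prox_cluster_near (prox_clusterP (g p))).
have [p [_ Fp]] := K_compact (F := e @ F) _ filterT.
suff adh C : (forall E, ~ d C E -> F (~` E)) -> closure (e @` C) p.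
  by exists p; split; apply: adh => E nE; apply: dF; [left|right].
(* Otherwise [C] is far from some member [D] of the cluster, and interpolation
   gives a member [~` E], taken from the filter, that is far from [D]. *)
move=> FC; apply: memh; apply: contrapT => /prox_clusterN[D pD].
move=> /prox_strong[E [/FC FE nED]].
have : g p (~` E).
  apply: memg; move: Fp; rewrite clusterE; apply.
  apply: (filterS _ FE : F (e @^-1` (e @` (~` E)))).
  exact: preimage_image.
by apply: prox_cluster_far pD _ => /prox_sym.
Qed.

Hypothesis e_dense : closure (range e) = setT.
Hypothesis proxE :
  forall A B, d A B <-> closure (e @` A) `&` closure (e @` B) !=set0.

Let closed_nbhd p (C : set K) : closed C -> ~ C p ->
  exists2 U, nbhs p U & closure U `&` C = set0.
Proof.
move=> cC nCp.
have /(_ (~` C))[] : {for p, regular_space K}.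
- by apply: (compact_regular K_hausdorff K_compact); exact: filterT.
- by apply: open_nbhs_nbhs; split => //; exact: closed_openC.
- by move=> U pU UC; exists U => //; exact/disjoints_subset.
Qed.

(** With [closed_nbhd], this gives the far pairs that are needed: every point
    not adherent to [A] has a neighborhood whose trace on [X] is far from
    [A]. *)
Let far_preimage A U : closure U `&` closure (e @` A) = set0 ->
  ~ d A (e @^-1` U).
Proof.
move=> UA /proxE[p [Ap Up]]; suff : set0 p by [].
rewrite -UA; split=> //; apply: closureS Up; exact: image_preimage_subset.
Qed.

Let trace_clusterP (p : K) :
  is_prox_cluster d [set A | closure (e @` A) p].
Proof.
split.
- by exists setT; rewrite /= e_dense.
- by move=> A B Ap Bp; apply/proxE; exists p.
- move=> C Cp /=; apply: contrapT => nCp.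
  have [U pU UC] := closed_nbhd (@closed_closure _ _) nCp.
  apply: (far_preimage UC); apply: Cp => /= V pV.
  have : closure (range e) p by rewrite e_dense.
  move=> /(_ _ (filterI pU pV))[_ [[x _ <-] [Ux Vx]]].
  by exists (e x); split => //; exists x.
- by move=> A B /=; rewrite image_setU closureU.
Qed.

Let trace (p : K) : smirnov d := ProxCluster (trace_clusterP p).

Let trace_inj p q : trace p = trace q -> p = q.
Proof.
move=> pq; apply: contrapT => npq.
have [|U pU UC] := @closed_nbhd p [set q] _ npq.
  exact/accessible_closed_set1/hausdorff_accessible.
have pU' : trace p (e @^-1` U).
  move=> V pV; have : closure (range e) p by rewrite e_dense.
  move=> /(_ _ (filterI pU pV))[_ [[x _ <-] [Ux Vx]]].
  by exists (e x); split => //; exists x.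
suff : set0 q by []; rewrite -UC; split=> //.
move: pU'; rewrite pq; apply: closureS; exact: image_preimage_subset.
Qed.

(** The point representing [s] is a cluster point of the filter dual to [s]: a
    member [A] of [s] not adherent to it would be far from the trace of some
    neighborhood, whose complement would then be in the filter. *)
Let trace_surj s : exists p, trace p = s.
Proof.
have sF := cluster_dual_filter s.
have [p [_ Fp]] := K_compact (F := e @ cluster_dual s) _ filterT.
exists p; apply/esym; apply: prox_cluster_eq => A sA /=.
apply: contrapT => nAp; have [U pU UA] := closed_nbhd (@closed_closure _ _) nAp.
have nsU := prox_cluster_far sA (far_preimage UA).
have [|v [nUv Uv]] := Fp (~` U) U _ pU; last exact: nUv.
by change (~ s (~` ~` (e @^-1` U))); rewrite setCK.
Qed.

Let trace_emb x : trace (e x) = smirnov_emb x.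
Proof.
apply/esym; apply: prox_cluster_eq => A /proxE[p [xp Ap]] /=.
suff -> : e x = p by [].
move: xp; rewrite image_set1 -(closure_id _).1//.
exact/accessible_closed_set1/hausdorff_accessible.
Qed.

(** The bijection [trace] pulls the closed set [[set s | s A]] back to the
    closure of [A] in [K], so it is continuous; its inverse is continuous since
    [K] is compact and the Smirnov space Hausdorff. *)
Lemma prox_smirnov_homeo : homeomorphic_compactifications (@smirnov_emb X d) e.
Proof.
pose h s := sval (cid (trace_surj s)).
have hK : cancel h trace by move=> s; exact: svalP (cid (trace_surj s)).
have tK : cancel trace h by move=> p; apply: trace_inj; rewrite hK.
have ct : continuous trace.
  apply/continuous_closedP => S /closure_id->; rewrite smirnov_closureE.
  by rewrite preimage_bigcap; apply: closed_bigI => A _; exact: closed_closure.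
exists h, trace; split=> //; last first.
  by move=> x; apply: trace_inj; rewrite hK trace_emb.
apply/continuous_closedP => C cC.
have -> : h @^-1` C = trace @` C.
  apply/seteqP; split=> [s Cs|_ [p Cp <-] /=]; last by rewrite tK.
  by exists (h s) => //; exact: hK.
apply: (compact_closed (@smirnov_hausdorff _ d)).
apply: continuous_compact; last exact: subclosed_compact cC K_compact _.
exact: continuous_subspaceT.
Qed.

End SmirnovUnique.

(** * Subspaces and products of topological spaces *)

Lemma hausdorff_continuous_inj (S T : topologicalType) (f : S -> T) :
  continuous f -> injective f -> hausdorff_space T -> hausdorff_space S.
Proof.
move=> cf f_inj hT x y xy; apply: f_inj; apply: hT => A B /cf fA /cf fB.
by have [z [Az Bz]] := xy _ _ fA fB; exists (f z).
Qed.

Lemma set_type_hausdorff (T : topologicalType) (A : set T) :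
  hausdorff_space T -> hausdorff_space (set_type A).
Proof.
apply: (@hausdorff_continuous_inj _ _ set_val); last exact: val_inj.
exact: initial_continuous.
Qed.

Lemma set_type_compact (T : topologicalType) (A : set T) :
  compact A -> compact [set: set_type A].
Proof.
move=> cA F FF _; have FA : F (set_val @^-1` A).
  by apply: filterS filterT => x _; exact: (set_valP x).
have [p [Ap Fp]] := cA (set_val @ F) _ FA.
exists (SigSub (mem_set Ap)); split=> // C V FC [_ [[W oW <-] Wp] WV].
have FC' : F (set_val @^-1` (set_val @` C)).
  by apply: filterS FC; exact: preimage_image.
have [_ [[x Cx <-] Wx]] := Fp _ W FC' (open_nbhs_nbhs (conj oW Wp)).
by exists x; split => //; exact: WV.
Qed.

Lemma continuous_set_type (S T : topologicalType) (A : set T)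
    (f : S -> set_type A) :
  continuous (set_val \o f) -> continuous f.
Proof.
move=> cf; apply/continuousP => _ [B oB <-].
by move/continuousP : cf; apply.
Qed.

Lemma continuous_prod_topology (S : topologicalType) (J : Type)
    (T : J -> topologicalType) (f : S -> prod_topology T) :
  (forall j, continuous (f^~ j)) -> continuous f.
Proof.
move=> cf x; apply/cvg_sup => j U [_ [[W oW <-] Wx] WU].
by apply: filterS WU _; apply: (cf j x); exact: open_nbhs_nbhs.
Qed.

(** * Separation by continuous functions *)

Section Separators.
Variables (R : realType).

Lemma uniform_separator_preimage (S T : topologicalType) (f : S -> T) A B :
  continuous f -> uniform_separator A B ->
  uniform_separator (f @^-1` A) (f @^-1` B).
Proof.
move=> cf /(uniform_separatorP (R := R))[g [cg g01 gA gB]].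
apply/(uniform_separatorP (R := R)); exists (g \o f); split.
- by move=> x; apply: continuous_comp; [exact: cf|exact: cg].
- by move=> _ [x _ <-]; apply: g01; exists (f x).
- by move=> _ [x Ax <-]; apply: gA; exists (f x).
- by move=> _ [x Bx <-]; apply: gB; exists (f x).
Qed.

Lemma uniform_separatorS (T : topologicalType) (A A' B B' : set T) :
  A `<=` A' -> B `<=` B' -> uniform_separator A' B' -> uniform_separator A B.
Proof.
move=> AA BB /(uniform_separatorP (R := R))[g [cg g01 gA gB]].
apply/(uniform_separatorP (R := R)); exists g; split => //.
- by apply: subset_trans gA; exact: image_subset.
- by apply: subset_trans gB; exact: image_subset.
Qed.

Lemma uniform_separator0 (T : topologicalType) (A : set T) :
  uniform_separator set0 A.
Proof.
apply/(uniform_separatorP (R := R)); exists (cst 1); split.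
- exact: cst_continuous.
- by move=> _ [x _ <-]; rewrite /= in_itv /= ler01 lexx.
- by rewrite image_set0.
- by move=> _ [x _ <-].
Qed.

End Separators.

(** * The Stone-Cech compactification *)

Section StoneCech.
Variables (R : realType) (X : topologicalType).
Local Notation beta := (stone_cech R X).
Local Notation eta := (@stone_cech_emb R X).

Lemma stone_cech_hausdorff : hausdorff_space beta.
Proof.
apply: set_type_hausdorff; apply: hausdorff_product => f.
by apply: set_type_hausdorff; exact: Rhausdorff.
Qed.

Lemma stone_cech_compact : compact [set: beta].
Proof.
apply: set_type_compact.
have cube_compact : compact [set: cube R X].
  rewrite (_ : setT = [set f : cube R X | forall i, setT (f i)]).
    apply: (@tychonoff _ (fun=> unit_interval R) (fun=> setT)) => _.
    apply: set_type_compact; exact: segment_compact.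
  exact/seteqP.
exact: subclosed_compact (@closed_closure _ _) cube_compact _.
Qed.

Lemma stone_cech_emb_continuous : continuous eta.
Proof.
apply: continuous_set_type; apply: continuous_prod_topology => f.
exact: cts_fun.
Qed.

Lemma stone_cech_dense : closure (range eta) = setT.
Proof.
apply/seteqP; split=> // p _ V [_ [[W oW <-] Wp] WV].
have [|_ [[x _ <-] Wx]] := set_valP p W; first exact: open_nbhs_nbhs.
by exists (eta x); split; [exists x|exact: WV].
Qed.

(** The extension is the projection of the cube on the coordinate [f]. *)
Lemma stone_cech_extend (f : X -> R) : continuous f -> range f `<=` `[0, 1] ->
  exists2 F : beta -> R, continuous F & F \o eta = f.
Proof.
move=> cf f01.
have f01x x : f x \in [set` `[0, 1]] by apply/mem_set/f01; exists x.
pose u x : unit_interval R := SigSub (f01x x).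
have cu : continuous u by exact: continuous_set_type.
pose uc : continuousType X (unit_interval R) := mkcts cu.
exists (fun p => set_val ((set_val p : cube R X) uc)) => //.
move=> p; apply: continuous_comp; last exact: initial_continuous.
apply: (@continuous_comp _ _ _ set_val (fun q : cube R X => q uc)).
  exact: initial_continuous.
exact: proj_continuous.
Qed.

(** A separating function extends, and the extension is constant, with distinct
    values, on the two closures; conversely disjoint closed sets of a normal
    space are separated, and a separation restricts to [X]. *)
Lemma stone_cech_closures (A B : set X) :
  uniform_separator A B <-> closure (eta @` A) `&` closure (eta @` B) = set0.
Proof.
split=> [/(uniform_separatorP (R := R))[f [cf f01 fA fB]]|AB].
  have [F /continuous_closedP cF Ff] := stone_cech_extend cf f01.
  have Fcl C c : f @` C `<=` [set c] -> closure (eta @` C) `<=` F @^-1` [set c].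
    move=> fC; have /closure_id -> : closed (F @^-1` [set c]).
      by apply: cF; exact: closed_eq.
    apply: closureS => _ [x Cx <-] /=.
    by apply: fC; exists x => //; rewrite -Ff.
  rewrite -subset0 => p [/(Fcl _ _ fA) /= Fp0 /(Fcl _ _ fB) /=].
  by rewrite Fp0 => /esym/eqP; rewrite oner_eq0.
have := compact_normal stone_cech_hausdorff stone_cech_compact.
move=> /(normal_separatorP (R := R)) sep.
have := sep _ _ (@closed_closure _ _) (@closed_closure _ _) AB.
move=> /(uniform_separator_preimage R stone_cech_emb_continuous).
apply: (uniform_separatorS R) => x Cx; apply: subset_closure;
  by exists x.
Qed.

End StoneCech.

(** Both sides say that nearness is meeting of closures in the Stone-Cech
    compactification. *)
Lemma smirnov_stone_cechP (R : realType) (X : Type) (d : proximity X) :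
  homeomorphic_compactifications
    (@smirnov_emb X d) (@stone_cech_emb R (prox_space d)) <->
  forall A B : set (prox_space d), d A B <-> ~ uniform_separator A B.
Proof.
have sepN (A B : set (prox_space d)) : ~ uniform_separator A B <->
    closure (@stone_cech_emb R _ @` A) `&` closure (@stone_cech_emb R _ @` B)
      !=set0.
  by rewrite (stone_cech_closures R) -set0P; split=> /eqP.
have bc := @stone_cech_compact R (prox_space d).
have bh := @stone_cech_hausdorff R (prox_space d).
split=> [hom A B|dE].
  by rewrite sepN; exact: smirnov_homeo_prox.
apply: prox_smirnov_homeo => //; first exact: stone_cech_dense.
by move=> A B; rewrite dE sepN.
Qed.

(** * Coproducts *)

Section Coproduct.
Variables (R : realType) (I : Type) (X : I -> Type).
Variable d : forall i, proximity (X i).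
Local Notation coprod := (coprod_prox d).

Lemma preimage_existT_image i (A : set (X i)) :
  existT X i @^-1` (existT X i @` A) = A.
Proof.
apply/seteqP; split=> [x [y Ay yx]|]; last exact: preimage_image.
by rewrite -(@existT_inj2 {classic I} X i y x yx).
Qed.

Lemma preimage_existT_image_neq i j (A : set (X i)) : i <> j ->
  existT X j @^-1` (existT X i @` A) = set0.
Proof.
move=> ij; rewrite -subset0 => x [y _ yx].
by apply: ij; exact: (congr1 (@projT1 _ _) yx).
Qed.

Lemma coprod_prox_image i (A : set (X i)) (B : set {i & X i}) :
  coprod (existT X i @` A) B <-> d i A (existT X i @^-1` B).
Proof.
split=> [[j]|dAB]; last by exists i; rewrite preimage_existT_image.
have [ij|ij] := pselect (i = j).
  by case: j / ij; rewrite preimage_existT_image.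
by rewrite preimage_existT_image_neq// => /prox_neq0[[]].
Qed.

(** The topology induced by the coproduct proximity is the disjoint union
    topology. *)
Lemma coprod_closedP (A : set (prox_space coprod)) :
  closed A <-> forall i, @closed (prox_space (d i)) (existT X i @^-1` A).
Proof.
rewrite prox_closedP; split=> [cA i|cA [i x]].
  apply/prox_closedP => x /coprod_prox_image; rewrite image_set1; exact: cA.
by rewrite -image_set1 => /coprod_prox_image; have /prox_closedP := cA i; apply.
Qed.

Lemma coprod_continuousP (T : topologicalType) (f : prox_space coprod -> T) :
  continuous f <->
  forall i, continuous (f \o existT X i : prox_space (d i) -> T).
Proof.
split=> [/continuous_closedP cf i|cf]; apply/continuous_closedP => C cC.
  by have /coprod_closedP := cf _ cC; apply.
apply/coprod_closedP => i.
by have /continuous_closedP := cf i; apply.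
Qed.

Lemma coprod_separatorP (A B : set (prox_space coprod)) :
  uniform_separator A B <-> forall i,
  @uniform_separator (prox_space (d i)) (existT X i @^-1` A)
                                        (existT X i @^-1` B).
Proof.
split=> [sAB i|sAB].
  apply: (uniform_separator_preimage R) sAB.
  have : continuous (@id (prox_space coprod)) by move=> x; exact: cvg_id.
  by move=> /coprod_continuousP; exact.
have fi i := cid (proj1 (@uniform_separatorP _ R _ _) (sAB i)).
apply/(uniform_separatorP (R := R)).
exists (fun z => sval (fi (projT1 z)) (projT2 z)); split.
- by apply/coprod_continuousP => i; have [] := svalP (fi i).
- by move=> _ [[i x] _ <-]; have [_ f01 _ _] := svalP (fi i);
  apply: f01; exists x.
- by move=> _ [[i x] Ax <-]; have [_ _ fA _] := svalP (fi i);
  apply: fA; exists x.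
- by move=> _ [[i x] Bx <-]; have [_ _ _ fB] := svalP (fi i);
  apply: fB; exists x.
Qed.

(** On the other summands the traces are empty, and separated by a constant. *)
Lemma coprod_separator_image i (A B : set (prox_space (d i))) :
  @uniform_separator (prox_space coprod) (existT X i @` A) (existT X i @` B) <->
  uniform_separator A B.
Proof.
rewrite coprod_separatorP; split=> [/(_ i)|sAB j].
  by rewrite !preimage_existT_image.
have [ij|ij] := pselect (i = j).
  by case: j / ij; rewrite !preimage_existT_image.
by rewrite preimage_existT_image_neq//; exact: uniform_separator0.
Qed.

End Coproduct.

Theorem theorem6p2 (R : realType) (I : Type) (X : I -> Type)
    (d : forall i : I, proximity (X i))
    (sep : forall i : I, separated_prox (d i)) :
  homeomorphic_compactifications
    (@smirnov_emb {i : I & X i} (coprod_prox d))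
    (@stone_cech_emb R (prox_space (coprod_prox d)))
  <->
  (forall i : I,
     homeomorphic_compactifications
       (@smirnov_emb (X i) (d i))
       (@stone_cech_emb R (prox_space (d i)))).
Proof.
split=> [/smirnov_stone_cechP dE i|dE]; apply/smirnov_stone_cechP => A B.
  by rewrite -(coprod_separator_image R) -dE coprod_prox_image
    preimage_existT_image.
rewrite (coprod_separatorP R) -existsNE; split=> -[i ABi]; exists i.
  by have /smirnov_stone_cechP <- := dE i.
by have /smirnov_stone_cechP -> := dE i.
Qed.
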